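(* Let $(G,T,\ell,u,w)$ be a PESP instance, let $\mathscr{B}$ be an integral cycle basis of $G$ with cycle matrix $\Gamma$, and let $Z$ be the corresponding cycle offset zonotope. Fix an arbitrary fine zonotopal tiling of $Z$. Then any tile is the image of $\mathscr{F}_{L,U}$ under $\frac{1}{T}\Gamma$ for a spanning tree structure $(S,L,U)$. If a tile contains an integer point $z\in Z$, then the polytrope $\mathfrak{R}(z)$ has a vertex defined by $(S,L,U)$.
   Context: A PESP instance $(G,T,\ell,u,w)$ consists of a finite directed graph $G$ with vertex set $V(G)$ and arc set $A(G)$, a positive integer $T$, and $\ell,u,w\in\mathbb{R}^{A(G)}$. Standing assumptions: $G$ is simple, 2-connected (as an undirected graph), has no pair of antiparallel arcs, and $0\le\ell_a<T$, $0<u_a-\ell_a<T$ for all arcs $a$. $B\in\{-1,0,1\}^{V(G)\times A(G)}$ is the incidence matrix of $G$ ($+1$ at the tail, $-1$ at the head of each arc). An oriented cycle is a vector $\gamma\in\{-1,0,1\}^{A(G)}$ with $B\gamma=0$, i.e. a circuit in $G$ whose arcs can be traversed in forward or backward direction. The cycle space is the abelian group generated by the oriented cycles; its rank is $\mu=|A(G)|-|V(G)|+1$. An integral cycle basis is a tuple $\mathscr{B}=(\gamma_1,\dots,\gamma_\mu)$ of oriented cycles generating the cycle space as a $\mathbb{Z}$-module; its cycle matrix is $\Gamma=(\gamma_1,\dots,\gamma_\mu)^\top$. For a matrix $M$, let $Z(M)=\{Mx\mid\mathbf{0}\le x\le\mathbf{1}\}$. The matrix $\Gamma'$ is obtained from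 $\Gamma$ by multiplying the column of each arc $a$ by $(u_a-\ell_a)/T$; for $S\subseteq A(G)$, $\Gamma'_S$ is obtained from $\Gamma'$ by deleting the columns indexed by $S$. The cycle offset zonotope is $Z=\{\Gamma x/T\mid \ell\le x\le u\}=Z(\Gamma')+\Gamma\ell/T\subset\mathbb{R}^{\mathscr{B}}$. A zonotopal tiling of $Z$ is a polyhedral subdivision of $Z$ such that the cells are translates of zonotopes $Z(\Gamma'_S)$, $S\subseteq A(G)$. The maximal cells are called tiles. The tiling is fine if all tiles are parallelotopes, i.e. the generators of each tile are linearly independent. A structure $(S,L,U)$ is a triple of subsets of $A(G)$ with $S=L\cup U$, $L\cap U=\varnothing$; it is a spanning tree structure if the subgraph induced by $S$ is a spanning tree of $G$ (orientations ignored). Let $X_{LP}=\prod_{a\in A(G)}[\ell_a,u_a]$ and $\mathscr{F}_{L,U}=\{x\in X_{LP}\mid x_a=\ell_a\ \forall a\in L,\ x_a=u_a\ \forall a\in U\}$, a face of $X_{LP}$. For $p\in\mathbb{Z}^{A(G)}$, $R(p)=\{\pi\in\mathbb{R}^{V(G)}\mid \ell_{ij}-Tp_{ij}\le\pi_j-\pi_i\le u_{ij}-Tp_{ij}\ \forall (i,j)\in A(G)\}$. For $z\in\mathbb{Z}^{\mathscr{B}}$, $\mathfrak{R}(z)$ denotes the image of $R(p)$, for any $p\in\mathbb{Z}^{A(G)}$ with $\Gamma p=z$, in the torus $(\mathbb{R}^{V(G)}/(T\mathbb{Z})^{V(G)})/\mathbb{R}\mathbf{1}$ (it is independent of the choice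 of $p$). $R(p)/\mathbb{R}\mathbf{1}$ maps injectively to the torus, and the vertices of $\mathfrak{R}(z)$ are the images of the vertices of the polytope $R(p)/\mathbb{R}\mathbf{1}$. A vertex of $\mathfrak{R}(z)$, represented by $\pi\in R(p)$, is defined by $(S,L,U)$ if the periodic tension $x=-B^\top\pi+Tp$ (i.e. $x_{ij}=\pi_j-\pi_i+Tp_{ij}$) satisfies $x_a=\ell_a$ for all $a\in L$ and $x_a=u_a$ for all $a\in U$. In the second part of the claim, $(S,L,U)$ is the spanning tree structure of the tile from the first part.
   Formalization: Cells of a zonotopal tiling are required to be Z(Γ'_S) translated by Γℓ/T plus the sum of the generators in U, for a structure (S,L,U); with arbitrary translates the claim fails (triangle with generators 0.6, 0.2, 0.2, Z cut into five segments of length 0.2). *)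

(* Defs.v *)
From HB Require Import structures.
From mathcomp Require Import all_boot all_order all_algebra.
From mathcomp Require Import boolp classical_sets functions cardinality reals.

Set Implicit Arguments.
Unset Strict Implicit.
Unset Printing Implicit Defensive.

Import Order.TTheory GRing.Theory Num.Theory.

Local Open Scope classical_set_scope.
Local Open Scope ring_scope.

(** * Directed graphs on the vertices ['I_n] with arcs ['I_m] *)

Record digraph (n m : nat) := Digraph {
  tail : 'I_m -> 'I_n;
  head : 'I_m -> 'I_n
}.

Section Graphs.
Variables (n m : nat) (G : digraph n m).

Definition simple_digraph : Prop :=
  (forall a, tail G a <> head G a) /\
  (forall a b, tail G a = tail G b -> head G a = head G b -> a = b).

Definition no_antiparallel : Prop :=
  forall a b, tail G a = head G b -> head G a <> tail G b.

(* Adjacency in the undirected graph with arc set S. *)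
Definition adj (S : {set 'I_m}) : rel 'I_n :=
  fun v w => [exists a in S, ((tail G a == v) && (head G a == w))
                          || ((tail G a == w) && (head G a == v))].

(* The undirected graph (D, S[D]) is connected. *)
Definition connected_on (D : {set 'I_n}) (S : {set 'I_m}) : Prop :=
  {in D &, forall v w,
     connect [rel x y | [&& x \in D, y \in D & adj S x y]] v w}.

Definition two_connected : Prop :=
  [/\ (2 < n)%N,
      connected_on [set: 'I_n] [set: 'I_m]
    & forall v, connected_on [set~ v] [set: 'I_m]].

(* For a simple digraph without antiparallel arcs, the circuits of the
   underlying undirected graph are the repetition-free closed vertex sequences
   of length at least 3; those of length 2 run back and forth along one arc. *)
Definition acyclic (S : {set 'I_m}) : Prop :=
  forall c : seq 'I_n, ucycle (adj S) c -> (size c <= 2)%N.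

Definition spanning_tree (S : {set 'I_m}) : Prop :=
  connected_on [set: 'I_n] S /\ acyclic S.

Definition incidence : 'M[int]_(n, m) :=
  \matrix_(v, a) ((tail G a == v)%:Z - (head G a == v)%:Z).

Definition oriented_cycle : set 'cV[int]_m :=
  [set g : 'cV[int]_m | (forall a, g a 0 \in [:: -1; 0; 1]) /\ incidence *m g = 0].

Definition zspan (X : set 'cV[int]_m) : set 'cV[int]_m :=
  [set c | exists (k : nat) (g : 'I_k -> 'cV[int]_m) (e : 'I_k -> int),
     (forall i, X (g i)) /\ c = \sum_(i < k) e i *: g i].

Definition cycle_space : set 'cV[int]_m := zspan oriented_cycle.

End Graphs.

(* The rank m - n + 1 of the cycle space of a connected graph, written so that
   the truncated subtraction is harmless (m >= n - 1 by connectedness). *)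
Definition cyclomatic (n m : nat) : nat := (m.+1 - n)%N.

Definition integral_cycle_basis (n m : nat) (G : digraph n m)
    (b : (cyclomatic n m).-tuple 'cV[int]_m) : Prop :=
  (forall i, oriented_cycle G (tnth b i)) /\
  zspan [set g : 'cV[int]_m | g \in b] = cycle_space G.

Definition cycle_matrix (k m : nat) (b : k.-tuple 'cV[int]_m) : 'M[int]_(k, m) :=
  \matrix_(i, a) tnth b i a 0.

Record structure (m : nat) := Structure {
  sS : {set 'I_m};
  sL : {set 'I_m};
  sU : {set 'I_m};
  sSE : sS = sL :|: sU;
  sLU : sL :&: sU = finset.set0
}.

Definition spanning_tree_structure (n m : nat) (G : digraph n m)
    (s : structure m) : Prop := spanning_tree G (sS s).

(** * Polyhedra, subdivisions and zonotopes in [R^d] *)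

Section Polyhedra.
Variable R : realType.

Definition in_box (d : nat) (l u : 'cV[R]_d) : set 'cV[R]_d :=
  [set x | forall i, l i 0 <= x i 0 <= u i 0].

Definition polyhedron (d : nat) (P : set 'cV[R]_d) : Prop :=
  exists (k : nat) (M : 'M[R]_(k, d)) (b : 'cV[R]_k),
    P = [set x | forall i, (M *m x) i 0 <= b i 0].

(* The points of P at which the linear functional c is maximal. *)
Definition maximizers (d : nat) (P : set 'cV[R]_d) (c : 'rV[R]_d) :
    set 'cV[R]_d :=
  [set x | P x /\ forall y, P y -> (c *m y) 0 0 <= (c *m x) 0 0].

(* P itself is the face given by c = 0. *)
Definition face (d : nat) (P F : set 'cV[R]_d) : Prop :=
  F = set0 \/ exists c, F = maximizers P c.

Definition polyhedral_subdivision (d : nat) (P : set 'cV[R]_d)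
    (C : set (set 'cV[R]_d)) : Prop :=
  [/\ finite_set C,
      forall Q, C Q -> polyhedron Q /\ Q !=set0,
      \bigcup_(Q in C) Q = P,
      forall Q F, C Q -> face Q F -> F !=set0 -> C F
    & forall Q Q', C Q -> C Q' ->
        face Q (Q `&` Q') /\ face Q' (Q `&` Q')].

Definition maximal_cell (d : nat) (C : set (set 'cV[R]_d)) : set (set 'cV[R]_d) :=
  [set Q | C Q /\ forall Q', C Q' -> Q `<=` Q' -> Q' = Q].

Definition translate (d : nat) (t : 'cV[R]_d) (P : set 'cV[R]_d) :
  set 'cV[R]_d := [set t + x | x in P].

Definition zonotope (d k : nat) (M : 'M[R]_(d, k)) : set 'cV[R]_d :=
  [set M *m x | x in in_box (const_mx 0) (const_mx 1)].

Definition delete_cols (d k : nat) (M : 'M[R]_(d, k)) (S : {set 'I_k}) :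
    'M[R]_(d, #|~: S|) :=
  colsub (fun j => enum_val j) M.

Definition independent_cols (d k : nat) (M : 'M[R]_(d, k)) : Prop :=
  row_free M^T.

End Polyhedra.

(** * PESP instances *)

Record pesp (R : realType) (n m : nat) := Pesp {
  graph : digraph n m;
  period : nat;
  lo : 'cV[R]_m;
  hi : 'cV[R]_m;
  weight : 'cV[R]_m
}.

Section Pesp.
Variables (R : realType) (n m : nat) (I : pesp R n m).
Local Notation G := (graph I).
Local Notation T := ((period I)%:R : R).

Definition pesp_instance : Prop :=
  [/\ (0 < period I)%N,
      simple_digraph G,
      two_connected G,
      no_antiparallel G
    & forall a, 0 <= lo I a 0 < T /\ 0 < hi I a 0 - lo I a 0 < T].

(* The face F_{L,U} of X_LP. *)
Definition lp_face (s : structure m) : set 'cV[R]_m :=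
  [set x | [/\ in_box (lo I) (hi I) x,
               {in sL s, forall a, x a 0 = lo I a 0}
             & {in sU s, forall a, x a 0 = hi I a 0}]].

Section Offsets.
Variables (k : nat) (Gam : 'M[int]_(k, m)).
Local Notation GamR := (map_mx intr Gam : 'M[R]_(k, m)).

Definition scaled_matrix : 'M[R]_(k, m) :=
  \matrix_(i, a) (GamR i a * ((hi I a 0 - lo I a 0) / T)).

Definition offset_map (x : 'cV[R]_m) : 'cV[R]_k := T^-1 *: (GamR *m x).

Definition cycle_offset_zonotope : set 'cV[R]_k :=
  [set offset_map x | x in in_box (lo I) (hi I)].

(* The translate of Z(Gamma'_S) selected by the sign vector (L, U): starting
   from the base point Gamma l / T of Z, the generators indexed by U are added
   in full and those indexed by L not at all. *)
Definition cell (s : structure m) : set 'cV[R]_k :=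
  translate (offset_map (lo I) + \sum_(a in sU s) col a scaled_matrix)
    (zonotope (delete_cols scaled_matrix (sS s))).

Definition cells (Sig : set (structure m)) : set (set 'cV[R]_k) :=
  [set cell s | s in Sig].

(* Zonotopal tilings are given by sign vectors (L, U), as is usual when
   generators may be parallel (here: the arcs of a 2-edge cut). Unlabelled
   tilings by arbitrary translates of the Z(Gamma'_S) are too weak a notion
   then: for a triangle whose generators are, up to scaling, 3, 1, 1 on the
   line, cutting the segment Z of length 5 into unit segments yields a middle
   tile that is not the image of a face of X_LP. *)
Definition zonotopal_tiling (Sig : set (structure m)) : Prop :=
  polyhedral_subdivision cycle_offset_zonotope (cells Sig).

Definition tile (Sig : set (structure m)) : set (set 'cV[R]_k) :=
  maximal_cell (cells Sig).

Definition fine (Sig : set (structure m)) : Prop :=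
  forall s, Sig s -> tile Sig (cell s) ->
    independent_cols (delete_cols scaled_matrix (sS s)).

End Offsets.

Definition tension (p : 'cV[int]_m) (pi : 'cV[R]_n) : 'cV[R]_m :=
  - ((map_mx intr (incidence G))^T *m pi) + T *: map_mx intr p.

Definition timetables (p : 'cV[int]_m) : set 'cV[R]_n :=
  [set pi | forall a,
     lo I a 0 - T * (p a 0)%:~R <= pi (head G a) 0 - pi (tail G a) 0
       <= hi I a 0 - T * (p a 0)%:~R].

(* The class of pi in R^V / R1. *)
Definition line_class (pi : 'cV[R]_n) : set 'cV[R]_n :=
  [set pi + const_mx c | c in [set: R]].

(* The class of pi in (R^V / (TZ)^V) / R1. *)
Definition torus_class (pi : 'cV[R]_n) : set 'cV[R]_n :=
  [set rho | exists (q : 'cV[int]_n) (c : R),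
     rho = pi + T *: map_mx intr q + const_mx c].

(* The class of pi is a vertex of P / R1, i.e. {[pi]} is a face of P / R1: the
   linear functionals on R^V / R1 are the functionals on R^V vanishing at 1. *)
Definition vertex_mod1 (P : set 'cV[R]_n) (pi : 'cV[R]_n) : Prop :=
  P pi /\ exists c : 'rV[R]_n,
    c *m const_mx 1 = 0 :> 'M_1 /\ maximizers P c = line_class pi.

Section Polytropes.
Variables (k : nat) (Gam : 'M[int]_(k, m)) (z : 'cV[int]_k).

Definition polytrope : set (set 'cV[R]_n) :=
  [set th | exists p pi,
     [/\ Gam *m p = z, timetables p pi & th = torus_class pi]].

Definition polytrope_vertex : set (set 'cV[R]_n) :=
  [set th | polytrope th /\ exists p pi,
     [/\ Gam *m p = z, vertex_mod1 (timetables p) pi & th = torus_class pi]].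

Definition defined_by (th : set 'cV[R]_n) (s : structure m) : Prop :=
  forall p pi, Gam *m p = z -> timetables p pi -> th = torus_class pi ->
    {in sL s, forall a, tension p pi a 0 = lo I a 0} /\
    {in sU s, forall a, tension p pi a 0 = hi I a 0}.

End Polytropes.

End Pesp.

(* Main.v *)
(** A circuit supported on S is an integral combination e Gamma of the basis, so
    e is constant on the cell of (S, L, U) but not on Z. A maximal cell is
    full-dimensional: its centre lies in no other cell, so it contains a
    neighbourhood of its centre in Z. Hence S is acyclic; it is connected because
    a vertex set left by no arc of S gives a cut, which lies in the kernel of
    Gamma and is supported off S, where the columns of Gamma are independent.

    For a spanning tree S, the fundamental cuts and the fundamental cycles
    determine each other, and the latter provide an integral inverse of the
    cotree columns of Gamma. So an integral point Gamma x / T with x in F_{L,U}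
    is Gamma p for an integral p, and x - T p is the tension of a potential pi.
    The functional summing the tensions over U minus those over L is maximal on
    R(p) exactly on the class of pi, because S is connected. *)

From mathcomp Require Import all_boot all_order all_algebra.
From mathcomp Require Import boolp classical_sets functions cardinality reals.
From mathcomp Require Import ring lra zify.
Require Import Defs.

Set Implicit Arguments.
Unset Strict Implicit.
Unset Printing Implicit Defensive.

Import Order.TTheory GRing.Theory Num.Theory.

Local Open Scope classical_set_scope.
Local Open Scope ring_scope.

(** * Matrix preliminaries: vectors supported on a set of coordinates *)

Lemma mulmx1C_eq (R : comPzRingType) (p q : nat) (A : 'M[R]_(p, q))
    (B : 'M[R]_(q, p)) : p = q -> A *m B = 1%:M -> B *m A = 1%:M.
Proof. by move=> pq; subst q; apply: mulmx1C. Qed.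

Lemma mulmx_support (R : pzSemiRingType) (k m : nat) (M : 'M[R]_(k, m))
    (A : {set 'I_m}) (w : 'cV[R]_m) : (forall a, a \notin A -> w a 0 = 0) ->
  colsub (fun j : 'I_#|A| => enum_val j) M
    *m rowsub (fun j : 'I_#|A| => enum_val j) w = M *m w.
Proof.
move=> w0; apply/matrixP => i j; rewrite !mxE ord1.
rewrite [RHS](bigID (mem A)) /= [X in _ + X]big1 ?addr0; last first.
  by move=> a aA; rewrite w0 ?mulr0.
rewrite [RHS](big_enum_val (fun a => M i a * w a 0)) /=.
by apply: eq_bigr => a _; rewrite !mxE.
Qed.

(** The sum has at most one term; this form avoids a default index in ['I_#|A|], which may be empty,
    and gives 0 off [A]. *)
Definition extend0 (R : pzSemiRingType) (m : nat) (A : {set 'I_m})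
    (y : 'cV[R]_#|A|) : 'cV[R]_m :=
  \col_a \sum_(j < #|A| | enum_val j == a) y j 0.

Lemma extend0_val (R : pzSemiRingType) (m : nat) (A : {set 'I_m})
    (y : 'cV[R]_#|A|) j : extend0 y (enum_val j) 0 = y j 0.
Proof.
rewrite mxE (big_pred1 j) // => i /=; apply/eqP/eqP => [/enum_val_inj//|->//].
Qed.

Lemma extend0_notin (R : pzSemiRingType) (m : nat) (A : {set 'I_m})
    (y : 'cV[R]_#|A|) a : a \notin A -> extend0 y a 0 = 0.
Proof.
move=> aA; rewrite mxE big1 // => j /eqP ja.
by rewrite -ja enum_valP in aA.
Qed.

Lemma extend0K (R : pzSemiRingType) (m : nat) (A : {set 'I_m})
    (y : 'cV[R]_#|A|) :
  rowsub (fun j : 'I_#|A| => enum_val j) (extend0 y) = y.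
Proof. by apply/matrixP => i j; rewrite ord1 mxE extend0_val. Qed.

Lemma independent_cols_eq0 (R : realType) (d k : nat) (M : 'M[R]_(d, k))
    (S : {set 'I_k}) (w : 'cV[R]_k) :
  independent_cols (delete_cols M S) ->
  {in S, forall a, w a 0 = 0} -> M *m w = 0 -> w = 0.
Proof.
move=> indep wS Mw; pose y := rowsub (fun j : 'I_#|~: S| => enum_val j) w.
have w0 a : a \notin ~: S -> w a 0 = 0 by rewrite inE negbK; apply: wS.
have y0 : y = 0.
  apply: trmx_inj; apply/eqP; rewrite trmx0 -(mulmx_free_eq0 _ indep).
  by rewrite -trmx_mul mulmx_support // Mw trmx0.
apply/matrixP => a j; rewrite ord1 [RHS]mxE.
have [aS|/w0//] := boolP (a \in ~: S).
have := congr1 (fun v : 'cV_ _ => v (enum_rank_in aS a) 0) y0.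
by rewrite !mxE enum_rankK_in.
Qed.

(** * Circuits, fundamental cuts and spanning trees *)

Section Graphs.
Variables (n m : nat) (G : digraph n m).
Implicit Types (S : {set 'I_m}) (a b c : 'I_m).

Lemma adjP S v w :
  reflect (exists2 a, a \in S & tail G a = v /\ head G a = w \/
                                tail G a = w /\ head G a = v) (adj G S v w).
Proof.
apply: (iffP exists_inP) => -[a aS h]; exists a => //.
  by case/orP: h => /andP[/eqP-> /eqP->]; [left|right].
by case: h => -[-> ->]; rewrite !eqxx ?orbT.
Qed.

Lemma adj_sym S : symmetric (adj G S).
Proof. by move=> v w; apply/adjP/adjP => -[a aS h]; exists a => //; tauto. Qed.

Lemma adj_arc S a : a \in S -> adj G S (tail G a) (head G a).
Proof. by move=> aS; apply/adjP; exists a => //; left. Qed.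

Lemma connected_onT S : connected_on G [set: 'I_n] S <->
  forall v w, connect (adj G S) v w.
Proof.
have e : [rel v w | [&& v \in [set: 'I_n]%SET, w \in [set: 'I_n]%SET
                      & adj G S v w]] =2 adj G S by move=> v w /=; rewrite !inE.
by split=> h v w => [|_ _]; [rewrite -(eq_connect e); apply: h; rewrite inE
                            |rewrite (eq_connect e)].
Qed.

Lemma connected_constant (V : eqType) S (h : 'I_n -> V) :
  connected_on G [set: 'I_n] S ->
  {in S, forall a, h (tail G a) = h (head G a)} -> forall v w, h v = h w.
Proof.
move=> /connected_onT conn hS v w.
have cl : closed (adj G S) [pred x | h x == h w].
  move=> x y /adjP[a aS h1]; rewrite !inE.
  by case: h1 (hS _ aS) => -[-> ->] ->.
by have := closed_connect cl (conn v w); rewrite !inE eqxx => /eqP.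
Qed.

Lemma mul_incidence (R : pzRingType) (h : 'rV[R]_n) a :
  (h *m map_mx intr (incidence G)) 0 a = h 0 (tail G a) - h 0 (head G a).
Proof.
rewrite mxE (eq_bigr (fun v => h 0 v * (tail G a == v)%:R
   - h 0 v * (head G a == v)%:R)); last first.
  by move=> v _; rewrite !mxE rmorphB /= -!pmulrn mulrBr.
have sel u : \sum_v h 0 v * (u == v)%:R = h 0 u.
  rewrite (bigD1 u) //= eqxx mulr1 big1 ?addr0 // => v.
  by rewrite eq_sym => /negbTE->; rewrite mulr0.
by rewrite sumrB !sel.
Qed.

Lemma incidence_mul (g : 'cV[int]_m) v : (incidence G *m g) v 0 =
  \sum_a g a 0 * ((tail G a == v)%:R - (head G a == v)%:R).
Proof. by rewrite mxE; apply: eq_bigr => a _; rewrite !mxE !natz mulrC. Qed.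

Lemma mul_trmx_incidence (R : comPzRingType) (pi : 'cV[R]_n) a :
  ((map_mx intr (incidence G))^T *m pi) a 0 =
  pi (tail G a) 0 - pi (head G a) 0.
Proof.
have := mul_incidence pi^T a; rewrite !mxE => <-.
by apply: eq_bigr => v _; rewrite !mxE mulrC.
Qed.

Hypotheses (Gsimple : simple_digraph G) (Ganti : no_antiparallel G).

Lemma unique_arc a b :
  tail G a = tail G b /\ head G a = head G b \/
  tail G a = head G b /\ head G a = tail G b -> a = b.
Proof.
case: Gsimple => _ inj; case=> [[t h]|[t h]]; first exact: inj.
by have := Ganti t h.
Qed.

(** By [unique_arc] a single arc of [S] joins the two vertices; not being a loop, it counts in only
    one of its two directions. *)
Lemma sum_adj S v w : adj G S v w ->
  \sum_(a in S) (((tail G a == v) && (head G a == w))%:R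
               + ((tail G a == w) && (head G a == v))%:R) = 1 :> int.
Proof.
case/adjP=> a aS h; rewrite (bigD1 a) //= big1 ?addr0.
  have /eqP nl := (proj1 Gsimple) a.
  by case: h nl => -[-> ->] /negbTE nl; rewrite !eqxx nl ?addr0 ?add0r.
move=> b /andP[bS ba].
case: andP => [[/eqP tb /eqP hb]|_].
  by case/eqP: ba; apply: unique_arc; rewrite tb hb; case: h => -[-> ->]; tauto.
case: andP => [[/eqP tb /eqP hb]|_]; last by rewrite addr0.
by case/eqP: ba; apply: unique_arc; rewrite tb hb; case: h => -[-> ->]; tauto.
Qed.

(** An arc of [S] gets 1 if the circuit runs through it forwards and -1 if backwards; flow is
    conserved because each vertex of the circuit is left once and entered once. *)
Lemma ucycle_circulation S (c : seq 'I_n) :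
  ucycle (adj G S) c -> (2 < size c)%N ->
  exists g : 'cV[int]_m, [/\ oriented_cycle G g, g != 0
    & forall a, a \notin S -> g a 0 = 0].
Proof.
case/andP=> cyc uc sz.
pose f (x y : 'I_n) : bool := (x \in c) && (next c x == y).
pose g : 'cV[int]_m := \col_a if a \in S then
  (f (tail G a) (head G a))%:R - (f (head G a) (tail G a))%:R else 0.
exists g; split.
- split=> [a|].
    by rewrite mxE; case: (a \in S) => //; do 2 case: (f _ _).
  apply/matrixP => v j; rewrite ord1 incidence_mul [RHS]mxE.
  (* [out] and [inn] count the traversals that leave and enter [v], whichever way the arc points. *)
  pose out a : int := ((tail G a == v) && f v (head G a))%:R
      + ((head G a == v) && f v (tail G a))%:R.
  pose inn a : int := ((tail G a == v) && f (head G a) v)%:R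
      + ((head G a == v) && f (tail G a) v)%:R.
  rewrite (bigID (mem S)) /= [X in _ + X]big1 ?addr0; last first.
    by move=> a /negbTE aS; rewrite mxE aS mul0r.
  rewrite (eq_bigr (fun a => out a - inn a)); last first.
    move=> a aS; rewrite mxE aS /out /inn.
    by case: eqP => [->|_]; case: eqP => [->|_] /=; ring.
  rewrite sumrB; have [vc|vc] := boolP (v \in c); last first.
    have fv x : f v x = false by rewrite /f (negbTE vc).
    have fv' x : f x v = false.
      apply/negbTE; rewrite /f; apply: contraNN vc => /andP[xc /eqP <-].
      by rewrite mem_next.
    by rewrite !big1 ?subrr // => a _; rewrite /out /inn ?fv ?fv' !andbF addr0.
  have -> : \sum_(a in S) out a = 1.
    rewrite -[RHS](sum_adj (next_cycle cyc vc)); apply: eq_bigr => a _.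
    rewrite /out /f vc /= ![next c v == _]eq_sym.
    by congr (_ + (nat_of_bool _)%:R); rewrite andbC.
  have -> : \sum_(a in S) inn a = 1; last by rewrite subrr.
  have fv x : f x v = (x == prev c v).
    rewrite /f; apply/andP/eqP => [[_ /eqP <-]|->]; first by rewrite prev_next.
    by rewrite mem_prev next_prev.
  rewrite -[RHS](sum_adj (prev_cycle cyc vc)); apply: eq_bigr => a _.
  rewrite /inn !fv addrC.
  by congr ((nat_of_bool _)%:R + (nat_of_bool _)%:R); rewrite andbC.
(* With at least three vertices the step from [x] to [y] is not undone by the next one, so its arc
   has a nonzero entry. *)
- case: c cyc uc sz @f @g => [|x [|y [|z c]]] // cyc uc _ f g.
  have /= /andP[xy _] := cyc; case/adjP: xy => a aS h.
  have fxy : f x y by rewrite /f !inE eqxx /= eqxx.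
  have fyx : f y x = false.
    apply/negbTE; rewrite /f !inE eqxx /= orbT /=.
    move: uc; rewrite /= !inE !negb_or => /andP[/and3P[xy xz _] _].
    by rewrite /= [y == x]eq_sym (negbTE xy) eqxx eq_sym.
  apply/eqP => /matrixP/(_ a 0); rewrite !mxE aS.
  by case: h => -[-> ->]; rewrite fxy fyx.
- by move=> a /negbTE aS; rewrite mxE aS.
Qed.

(** For a tree [S], this is the side of the tail when [b] is removed, and [cut] is the signed
    fundamental cut of [b]. *)
Definition cut_side S b : {set 'I_n} :=
  [set v | connect (adj G (S :\ b)) (tail G b) v].

Definition cut S b a : int :=
  (tail G a \in cut_side S b)%:R - (head G a \in cut_side S b)%:R.

(** An arc of [S] other than [b] keeps both ends on one side. If [b] did not cross its own cut, a
    path avoiding [b] would close up with [b] to a circuit. *)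
Lemma cut_tree S : acyclic G S -> {in S &, forall b a, cut S b a = (a == b)%:R}.
Proof.
move=> acyc b a bS aS; rewrite /cut !inE.
have sym : connect_sym (adj G (S :\ b)).
  by apply: sym_connect_sym; apply: adj_sym.
have [->|ab] := eqVneq a b; last first.
  have e : connect (adj G (S :\ b)) (tail G a) (head G a).
    by apply/connect1/adj_arc; rewrite !inE ab.
  by rewrite (same_connect_r sym e) subrr.
rewrite connect0; case: connectP => [[p0 pth]|_]; last by rewrite subr0.
case/shortenP: pth => p pth up _ lst; exfalso.
have sub : subrel (adj G (S :\ b)) (adj G S).
  move=> v w /adjP[x]; rewrite inE => /andP[_ xS] h.
  by apply/adjP; exists x.
have : ucycle (adj G S) (tail G b :: p).
  rewrite /ucycle up andbT /= rcons_path (sub_path sub pth) -lst.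
  by rewrite adj_sym adj_arc.
(* Acyclicity leaves a path of at most one arc: with none [b] is a loop, with one it has a parallel
   or antiparallel twin. *)
move/acyc; case: p pth lst {up} => [|x [|y p]] //=.
  by move=> _ h; have := proj1 Gsimple b; rewrite h.
rewrite andbT => /adjP[x' x'S h] hx _; rewrite -hx in h.
move: x'S; rewrite !inE => /andP[/eqP ne _].
by apply: ne; apply: unique_arc; tauto.
Qed.

(** Subtracting the combination of cut sides from [h] leaves a function without drop along any arc
    of [S], by [cut_tree], hence a constant. *)
Lemma tree_potential (R : pzRingType) S (h : 'I_n -> R) v w :
  spanning_tree G S ->
  h v - h w = \sum_(b in S) (h (tail G b) - h (head G b)) *
                ((v \in cut_side S b)%:R - (w \in cut_side S b)%:R).
Proof.
case=> conn acyc.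
pose g x := h x - \sum_(b in S) (h (tail G b) - h (head G b)) *
  (x \in cut_side S b)%:R.
have gE x y : g x - g y = h x - h y -
  \sum_(b in S) (h (tail G b) - h (head G b)) *
     ((x \in cut_side S b)%:R - (y \in cut_side S b)%:R).
  rewrite (eq_bigr _ (fun b _ => mulrBr _ _ _)) sumrB /g !opprB.
  rewrite [X in _ + X]addrC addrACA; congr (_ + _); exact: addrC.
suff /(_ v w)/eqP : forall x y, g x = g y.
  by rewrite -subr_eq0 gE subr_eq0 => /eqP.
apply: (connected_constant conn) => a aS; apply/eqP; rewrite -subr_eq0 gE.
rewrite (bigD1 a) //= big1 ?addr0.
  have /(congr1 (intr : int -> R)) := cut_tree acyc aS aS.
  by rewrite /cut rmorphB /= !rmorph_nat eqxx => ->; rewrite mulr1 subrr.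
move=> b /andP[bS ba].
have /(congr1 (intr : int -> R)) := cut_tree acyc bS aS.
rewrite /cut rmorphB /= !rmorph_nat eq_sym (negbTE ba) => ->.
by rewrite mulr0.
Qed.

Definition fundamental_cycle S a : 'cV[int]_m :=
  \col_c ((c == a)%:R - (if c \in S then cut S c a else 0)).

(* The fundamental cycles are read off the fundamental cuts by duality. *)
Lemma fundamental_cycle_oriented S a : spanning_tree G S -> a \notin S ->
  oriented_cycle G (fundamental_cycle S a).
Proof.
move=> tree aS; split=> [c|].
  rewrite mxE; case: eqVneq => [->|_]; first by rewrite (negbTE aS).
  by case: (c \in S) => //; rewrite /cut;
    case: (tail G a \in _); case: (head G a \in _).
apply/matrixP => v j; rewrite ord1 incidence_mul [RHS]mxE.
rewrite (eq_bigr (fun c => (c == a)%:R *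
      ((tail G c == v)%:R - (head G c == v)%:R)
    - (if c \in S then
         ((tail G c == v)%:R - (head G c == v)%:R) * cut S c a else 0)));
  last first.
  by move=> c _; rewrite mxE; case: (c \in S); ring.
(* For the indicator of [v], [tree_potential] turns the sum over the tree into the boundary of [a]
   at [v], which cancels the term of [a] itself. *)
rewrite sumrB -big_mkcond -(tree_potential (fun x => (x == v)%:R)) //.
rewrite (bigD1 a) //= eqxx mul1r big1 ?addr0 ?subrr // => c /negbTE->.
by rewrite mul0r.
Qed.

(** The cut sides form a left inverse [M] of the tree columns [B] of the incidence matrix, so [S]
    has at most [n] arcs. With equality [B *m M] would be the identity, but the all-ones row
    annihilates [B]. *)
Lemma spanning_tree_card S : spanning_tree G S -> (0 < n)%N -> (#|S| < n)%N.
Proof.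
move=> [conn acyc] n0.
pose M : 'M[int]_(#|S|, n) := \matrix_(j, v) (v \in cut_side S (enum_val j))%:R.
pose B : 'M[int]_(n, #|S|) := colsub (fun j => enum_val j) (incidence G).
have incE (h : 'rV[int]_n) a :
    (h *m incidence G) 0 a = h 0 (tail G a) - h 0 (head G a).
  rewrite -mul_incidence; congr ((_ *m _) 0 a); apply/matrixP => i j.
  by rewrite !mxE intz.
have BE (h : 'rV[int]_n) j : (h *m B) 0 j =
    h 0 (tail G (enum_val j)) - h 0 (head G (enum_val j)).
  by rewrite -incE !mxE; apply: eq_bigr => v _; rewrite !mxE.
have MB : M *m B = 1%:M.
  apply/row_matrixP => j; rewrite row_mul; apply/matrixP => i c; rewrite ord1.
  rewrite BE !mxE -/(cut S (enum_val j) (enum_val c)) cut_tree ?enum_valP //.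
  by rewrite (inj_eq enum_val_inj) eq_sym.
have := mulmx1_min MB; rewrite leq_eqVlt => /orP[/eqP e|//].
have := congr1 (mulmx (const_mx 1 : 'rV_n)) (mulmx1C_eq e MB).
rewrite mulmxA mulmx1.
have -> : const_mx 1 *m B = 0 :> 'rV_ _.
  by apply/matrixP => i c; rewrite ord1 BE !mxE subrr.
by rewrite mul0mx => /matrixP/(_ 0 (Ordinal n0)); rewrite !mxE.
Qed.

End Graphs.

(** * The cycle matrix of an integral cycle basis *)

Section CycleBasis.
Variables (n m : nat) (G : digraph n m).
Variable b : (cyclomatic n m).-tuple 'cV[int]_m.
Hypothesis bP : integral_cycle_basis G b.
Local Notation Gam := (cycle_matrix b).

Lemma oriented_cycle_coord (g : 'cV[int]_m) : oriented_cycle G g ->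
  exists e : 'rV[int]_(cyclomatic n m), g^T = e *m Gam.
Proof.
move=> gP; have : cycle_space G g.
  exists 1%N, (fun=> g), (fun=> 1); split=> //.
  by rewrite big_ord1 scale1r.
rewrite -bP.2 => -[K [f [e [fb ->]]]].
have /fin_all_exists[j fj] i : exists j, f i = tnth b j by apply/tnthP/fb.
exists (\sum_i e i *: delta_mx 0 (j i)).
rewrite mulmx_suml linear_sum; apply: eq_bigr => i _ /=.
rewrite -scalemxAl -rowE linearZ /= fj; congr (_ *: _).
by apply/matrixP => r c; rewrite !mxE ord1.
Qed.

Lemma cycle_matrix_incidence : Gam *m (incidence G)^T = 0.
Proof.
apply/row_matrixP => i; rewrite row_mul row0; apply: trmx_inj.
rewrite trmx_mul trmxK trmx0 -[RHS](proj2 (bP.1 i)); congr (_ *m _).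
by apply/matrixP => r c; rewrite !mxE ord1.
Qed.

Hypotheses (Gsimple : simple_digraph G) (Ganti : no_antiparallel G).
Hypothesis n_gt0 : (0 < n)%N.

(** The rows of [E] are the coordinates of the fundamental cycles, which restrict to unit vectors on
    the cotree. The inverse is two-sided because the matrices are square, by
    [spanning_tree_card]. *)
Lemma cycle_matrix_cotree_inverse (S : {set 'I_m}) : spanning_tree G S ->
  exists E : 'M[int]_(#|~: S|, cyclomatic n m),
    E *m colsub (fun j : 'I_#|~: S| => enum_val j) Gam = 1%:M /\
    colsub (fun j : 'I_#|~: S| => enum_val j) Gam *m E = 1%:M.
Proof.
move=> tree.
have /fin_all_exists[e eP] (j : 'I_#|~: S|) :
    exists e, (fundamental_cycle G S (enum_val j))^T = e *m Gam.
  apply: oriented_cycle_coord; apply: fundamental_cycle_oriented => //.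
  by have := enum_valP j; rewrite inE.
exists (\matrix_j e j); set E := \matrix_j _.
have EG : E *m colsub (fun j : 'I_#|~: S| => enum_val j) Gam = 1%:M.
  apply/row_matrixP => j; rewrite row_mul rowK; apply/matrixP => r c.
  have := congr1 (fun M : 'rV_m => M 0 (enum_val c)) (eP j).
  rewrite ord1 !mxE (inj_eq enum_val_inj) eq_sym => h.
  have := enum_valP c; rewrite inE => /negbTE cS; rewrite cS subr0 in h.
  by rewrite h; apply: eq_bigr => i _; rewrite !mxE.
split=> //; apply: (mulmx1C_eq _ EG).
have := mulmx1_min EG; have := spanning_tree_card Gsimple Ganti tree n_gt0.
have := cardsC S; rewrite card_ord /cyclomatic; lia.
Qed.

Lemma cycle_matrix_surj (S : {set 'I_m}) (z : 'cV[int]_(cyclomatic n m)) :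
  spanning_tree G S -> exists p, Gam *m p = z.
Proof.
move=> /cycle_matrix_cotree_inverse[E [_ GE]].
exists (extend0 (E *m z)); rewrite -(mulmx_support _ (A := ~: S)).
  by rewrite extend0K mulmxA GE mul1mx.
by move=> a aS; rewrite extend0_notin.
Qed.

(* y - sum_b y_b cut_b vanishes on the tree, and Gamma is injective on the
   vectors supported on the cotree. *)
Lemma cycle_matrix_ker (R : comPzRingType) (S : {set 'I_m}) (y : 'cV[R]_m) :
  spanning_tree G S -> map_mx intr Gam *m y = 0 ->
  exists pi : 'cV[R]_n, y = (map_mx intr (incidence G))^T *m pi.
Proof.
move=> tree Gy; have [E [EG _]] := cycle_matrix_cotree_inverse tree.
pose pi : 'cV[R]_n := \col_v \sum_(a in S) y a 0 * (v \in cut_side G S a)%:R.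
have piE a : ((map_mx intr (incidence G))^T *m pi) a 0 =
    \sum_(c in S) y c 0 * (cut G S c a)%:~R.
  rewrite mul_trmx_incidence !mxE -sumrB; apply: eq_bigr => c _.
  by rewrite -mulrBr /cut rmorphB /= !rmorph_nat.
exists pi; set y' := _ *m pi.
have Gy' : map_mx intr Gam *m (y - y') = 0.
  rewrite mulmxBr Gy /y' mulmxA map_trmx -map_mxM cycle_matrix_incidence.
  by rewrite map_mx0 mul0mx subr0.
have yS a : a \notin ~: S -> (y - y') a 0 = 0.
  rewrite inE negbK => aS; rewrite mxE [X in _ + X]mxE piE (bigD1 a) //=.
  rewrite cut_tree ?eqxx ?mulr1 ?big1 ?addr0 ?subrr //.
  - move=> c /andP[cS ca]; rewrite cut_tree // 1?eq_sym ?(negbTE ca) ?mulr0 //.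
    exact: tree.2.
  - exact: tree.2.
apply/eqP; rewrite -subr_eq0; apply/eqP/matrixP => a r; rewrite ord1 [RHS]mxE.
have [aS|/yS//] := boolP (a \in ~: S).
have := mulmx_support (map_mx intr Gam) yS; rewrite Gy'.
move/(congr1 (mulmx (map_mx intr E))); rewrite mulmx0 mulmxA.
have -> : colsub (fun j : 'I_#|~: S| => enum_val j) (map_mx intr Gam) =
  map_mx (intr : int -> R) (colsub (fun j : 'I_#|~: S| => enum_val j) Gam).
  by apply/matrixP => i j; rewrite !mxE.
rewrite -map_mxM EG map_mx1 mul1mx => /matrixP/(_ (enum_rank_in aS a) 0).
by rewrite !mxE enum_rankK_in.
Qed.

End CycleBasis.

(** * Maximal cells of a polyhedral subdivision *)

Section Subdivision.
Variables (R : realType) (d : nat).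
Implicit Types (P Q : set 'cV[R]_d) (x v : 'cV[R]_d).

Lemma polyhedron_exit P x v : polyhedron P -> ~ P x ->
  exists2 eps : R, 0 < eps & forall t, 0 < t <= eps -> ~ P (x + t *: v).
Proof.
case=> k [M [c ->]] /= /existsNP[i /negP]; rewrite -ltNge => lt_i.
set q := (M *m v) i 0; set dl := (M *m x) i 0 - c i 0.
have dl0 : 0 < dl by rewrite subr_gt0.
have q0 : 0 <= `|q| by [].
(* [dl] is the violation at [x], and a step [t] lowers it by at most [t] times the absolute value of
   [q]; the summand 1 keeps what remains positive. *)
exists (dl / (1 + `|q|)); first by rewrite divr_gt0 // ltr_pwDl.
move=> t /andP[t0 tle] /(_ i); rewrite mulmxDr -scalemxAr mxE [X in _ + X]mxE -/q.
rewrite ler_pdivlMr ?ltr_pwDl // in tle.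
have := ler_norm (- q); rewrite normrN => nq le.
have := ler_wpM2l (ltW t0) nq; rewrite /dl in tle *; lra.
Qed.

(* The points x + t v, t > 0 small, can only be covered by Q itself: as Q is
   symmetric around x, any cell containing x contains Q. *)
Lemma maximal_cell_direction P (C : set (set 'cV[R]_d)) Q x v :
  polyhedral_subdivision P C -> maximal_cell C Q -> Q x ->
  (forall y, Q y -> Q (x + x - y)) ->
  (forall t, 0 <= t <= 1 -> P (x + t *: v)) ->
  exists2 t : R, 0 < t & Q (x + t *: v).
Proof.
case=> fin poly cover faces inter [CQ maxQ] Qx symQ Pv.
(* The common face contains [x]. A functional maximal at [x] is constant on [Q], as [y] and its
   mirror image change it in opposite directions; so the face is all of [Q]. *)
have only Q' : C Q' -> Q' x -> Q' = Q.
  move=> CQ' Q'x; apply: maxQ => // y Qy.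
  have [[e|[c e]] _] := inter _ _ CQ CQ'.
    by have : (Q `&` Q') x by []; rewrite e.
  have : (Q `&` Q') x by []; rewrite e => -[_ cx].
  suff : (Q `&` Q') y by case.
  rewrite e; split=> // w Qw; apply: le_trans (cx _ Qw) _.
  have := cx _ (symQ _ Qy); rewrite !mulmxDr mulmxN mxE [X in X + _]mxE.
  by rewrite [X in _ + X]mxE; lra.
have [s sC] := (finite_seqP _).1 fin.
(* Induction on the list of cells gives one [eps] for all: it shrinks for each cell that misses [x],
   while a cell containing [x] equals [Q]. *)
have [eps eps0 epsP] : exists2 eps : R, 0 < eps &
    forall t Q', 0 < t <= eps -> Q' \in s -> C Q' -> Q' (x + t *: v) -> Q' = Q.
  elim: s {sC} => [|Q' s [eps eps0 IH]]; first by exists 1.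
  have [CQ'|nCQ'] := pselect (C Q'); last first.
    exists eps => // t Q'' ht; rewrite inE => /orP[/eqP->//|]; exact: IH.
  have [Q'x|/(polyhedron_exit v (proj1 (poly _ CQ')))] := pselect (Q' x).
    exists eps => // t Q'' ht; rewrite inE => /orP[/eqP->|]; last exact: IH.
    by move=> _ _; apply: only.
  case=> eps' eps'0 out; exists (Num.min eps eps'); first by rewrite lt_min eps0.
  move=> t Q'' /andP[t0]; rewrite le_min => /andP[te te'].
  rewrite inE => /orP[/eqP->|] h1 h2; last by apply: IH; rewrite ?t0.
  by have := out t; rewrite t0 te' => /(_ isT).
pose t := Num.min 1 eps.
have t0 : 0 < t by rewrite lt_min ltr01.
have : P (x + t *: v) by apply: Pv; rewrite ltW //= ge_min lexx.
rewrite -cover => -[Q' CQ' Q't]; exists t => //.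
rewrite -(epsP t Q') // ?t0 ?ge_min ?lexx ?orbT //.
by have := CQ'; rewrite sC.
Qed.

End Subdivision.

(** * Faces of the box and tiles of the zonotope *)

Section Pesp.
Variables (R : realType) (n m : nat) (I : pesp R n m).
Hypothesis IP : pesp_instance I.
Local Notation G := (graph I).
Local Notation T := ((period I)%:R : R).
Local Notation width a := (hi I a 0 - lo I a 0).

Lemma period_gt0 : 0 < T.
Proof. by case: IP => T0 *; rewrite ltr0n. Qed.

Lemma width_bounds a : 0 < width a < T.
Proof. by case: IP => _ _ _ _ /(_ a)[]. Qed.

Lemma arc_cases (s : structure m) a :
  [\/ a \in sL s /\ a \notin sU s, a \in sU s /\ a \notin sL s | a \notin sS s].
Proof.
have := congr1 (fun A : {set 'I_m} => a \in A) (sSE s).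
have := congr1 (fun A : {set 'I_m} => a \in A) (sLU s); rewrite !inE => h ->.
by move: h; case: (a \in sL s); case: (a \in sU s) => // _;
  [apply: Or31|apply: Or32|apply: Or33].
Qed.

Lemma in_structure (s : structure m) a : (a \in sS s) = (a \in sL s) || (a \in sU s).
Proof. by rewrite sSE inE. Qed.

Lemma lp_face_eq (s : structure m) x y : lp_face I s x -> lp_face I s y ->
  {in sS s, forall a, x a 0 = y a 0}.
Proof.
move=> [_ xL xU] [_ yL yU] a; rewrite in_structure => /orP[aS|aS].
  by rewrite xL ?yL.
by rewrite xU ?yU.
Qed.

Section Matrix.
Variables (k : nat) (Gam : 'M[int]_(k, m)).
Local Notation GamR := (map_mx intr Gam : 'M[R]_(k, m)).

Lemma offset_map_param (t : 'cV[R]_m) :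
  offset_map I Gam (\col_a (lo I a 0 + width a * t a 0)) =
  offset_map I Gam (lo I) + scaled_matrix I Gam *m t.
Proof.
apply/matrixP => i j; rewrite ord1 !mxE !mulr_sumr -big_split /=.
by apply: eq_bigr => a _; rewrite !mxE; ring.
Qed.

Lemma scaled_matrix_eq0 (w : 'cV[R]_m) : GamR *m w = 0 ->
  scaled_matrix I Gam *m (\col_a (w a 0 * T / width a)) = 0.
Proof.
move=> Gw; rewrite -Gw; apply/matrixP => i j; rewrite ord1 !mxE.
apply: eq_bigr => a _; rewrite !mxE.
have T0 := lt0r_neq0 period_gt0.
have w0 : width a != 0 by apply: lt0r_neq0; case/andP: (width_bounds a).
by field; rewrite T0 w0.
Qed.

(** Substitute [x a = lo a + width a * t a], where [t] is the indicator of [sU s] plus a vector [y]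
    supported off [sS s]; [shape] serves both inclusions. *)
Lemma cellE (s : structure m) :
  cell I Gam s = offset_map I Gam @` lp_face I s.
Proof.
have colsU : \sum_(a in sU s) col a (scaled_matrix I Gam) =
    scaled_matrix I Gam *m \col_a (a \in sU s)%:R.
  apply/matrixP => i j; rewrite ord1 summxE mxE big_mkcond; apply: eq_bigr => a _.
  by rewrite !mxE; case: (a \in sU s); rewrite ?mulr1 ?mulr0.
have shape (t y : 'cV[R]_m) : (forall a, a \notin ~: sS s -> y a 0 = 0) ->
    t = \col_a (a \in sU s)%:R + y ->
    offset_map I Gam (\col_a (lo I a 0 + width a * t a 0)) =
    offset_map I Gam (lo I) + \sum_(a in sU s) col a (scaled_matrix I Gam) +
    delete_cols (scaled_matrix I Gam) (sS s)
      *m rowsub (fun j : 'I_#|~: sS s| => enum_val j) y.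
  move=> y0 ->; rewrite offset_map_param mulmxDr -colsU addrA; congr (_ + _).
  by rewrite /delete_cols mulmx_support.
apply/seteqP; split => [_ [_ [y box_y <-] <-]|_ [x [box_x xL xU] <-]].
  pose t : 'cV[R]_m := \col_a (a \in sU s)%:R + extend0 y.
  exists (\col_a (lo I a 0 + width a * t a 0)); last first.
    rewrite (shape t (extend0 y)) ?extend0K // => a aS; exact: extend0_notin.
  have tE a : t a 0 = (a \in sU s)%:R + extend0 y a 0.
    by rewrite [LHS]mxE [X in X + _]mxE.
  split=> [a|a aL|a aU]; rewrite mxE tE.
  - have /andP[w0 _] := width_bounds a.
    have [aS|aS] := boolP (a \in sS s).
      rewrite extend0_notin ?inE ?aS // addr0.
      by case: (a \in sU s); rewrite ?mulr1 ?mulr0; lra.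
    have aS' : a \in ~: sS s by rewrite inE.
    have := aS; rewrite in_structure negb_or => /andP[_ /negbTE->].
    rewrite add0r -(enum_rankK_in aS' aS') extend0_val enum_rankK_in //.
    have := box_y (enum_rank_in aS' a); rewrite !mxE => /andP[h0 h1].
    by apply/andP; split; nra.
  - case: (arc_cases s a) => [[_ /negbTE->]|[_]|]; rewrite ?in_structure ?aL //.
    by rewrite extend0_notin ?inE ?negbK ?in_structure ?aL // !(addr0, mulr0).
  - rewrite aU extend0_notin ?inE ?negbK ?in_structure ?aU ?orbT // addr0 mulr1.
    by rewrite addrC subrK.
pose t : 'cV[R]_m := \col_a ((x a 0 - lo I a 0) / width a).
pose y : 'cV[R]_m := \col_a (t a 0 - (a \in sU s)%:R).
have w0 a : 0 < width a by case/andP: (width_bounds a).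
have xt : x = \col_a (lo I a 0 + width a * t a 0).
  apply/matrixP => a j; rewrite ord1 !mxE mulrC divfK ?lt0r_neq0 //; ring.
have y0 a : a \notin ~: sS s -> y a 0 = 0.
  rewrite inE negbK in_structure !mxE => aS.
  case: (arc_cases s a) aS => [[aL /negbTE->]|[aU _]|]; last 1 first.
  - by rewrite in_structure => /negbTE->.
  - by rewrite xL // subrr mul0r subr0.
  - by rewrite aU xU // divff ?subrr // lt0r_neq0.
have ty : t = \col_a (a \in sU s)%:R + y.
  by apply/matrixP => a j; rewrite ord1 !mxE; ring.
exists (delete_cols (scaled_matrix I Gam) (sS s)
      *m rowsub (fun j : 'I_#|~: sS s| => enum_val j) y); last first.
  by rewrite -(shape t y) // -xt.
exists (rowsub (fun j : 'I_#|~: sS s| => enum_val j) y) => // j.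
have := enum_valP j; rewrite inE in_structure negb_or => /andP[_ /negbTE aU].
rewrite !mxE aU subr0; have := box_x (enum_val j) => /andP[h0 h1].
apply/andP; split; first by rewrite divr_ge0 ?(ltW (w0 _)) // subr_ge0.
by rewrite ler_pdivrMr ?w0 // mul1r lerB.
Qed.

(** The cut vector [w] of a component [D] of [S] vanishes on [S] and lies in the kernel of [Gam];
    independence off [S] makes it zero. No arc then leaves [D], and the whole graph is connected. *)
Lemma cell_connected (s : structure m) :
  Gam *m (incidence G)^T = 0 ->
  independent_cols (delete_cols (scaled_matrix I Gam) (sS s)) ->
  connected_on G [set: 'I_n] (sS s).
Proof.
move=> GB indep; apply/connected_onT => v.
case: IP => _ _ [_ conn _] _ _.
pose D := [pred x | connect (adj G (sS s)) v x].
pose w : 'cV[R]_m := \col_a ((tail G a \in D)%:R - (head G a \in D)%:R).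
have Gw : GamR *m w = 0.
  have -> : w = (map_mx intr (incidence G))^T *m \col_x (x \in D)%:R.
    by apply/matrixP => a i; rewrite ord1 mul_trmx_incidence !mxE.
  by rewrite mulmxA map_trmx -map_mxM GB map_mx0 mul0mx.
have wS : {in sS s, forall a, w a 0 = 0}.
  move=> a aS; rewrite mxE !inE.
  have sym : connect_sym (adj G (sS s)) by apply/sym_connect_sym/adj_sym.
  by rewrite (same_connect_r sym (connect1 (adj_arc G aS))) subrr.
have w0 : \col_a (w a 0 * T / width a) = 0 :> 'cV_m.
  apply: (independent_cols_eq0 indep); last exact: scaled_matrix_eq0.
  by move=> a aS; rewrite mxE wS // !mul0r.
suff Dconst x y : (x \in D) = (y \in D).
  by move=> x; have := Dconst x v; rewrite !inE connect0.
apply: (connected_constant (h := fun x => x \in D) conn) => a _.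
have := congr1 (fun M : 'cV_m => M a 0) w0; rewrite !mxE.
have T0 := lt0r_neq0 period_gt0.
have wa0 : width a != 0 by apply: lt0r_neq0; case/andP: (width_bounds a).
move/eqP; rewrite !mulf_eq0 invr_eq0 (negbTE wa0) (negbTE T0) !orbF.
by case: (tail G a \in D); case: (head G a \in D) => //;
  rewrite /= ?subr0 ?sub0r ?oppr_eq0 ?oner_eq0.
Qed.

(** The functional [e] reads only coordinates in [sS s], which are fixed on the face. Maximality
    allows a small move along an arc [a] of [sS s] inside the cell, so the entry of [g] at [a] must
    vanish. *)
Lemma maximal_cell_support (Sig : set (structure m)) (s : structure m)
    (g : 'cV[int]_m) (e : 'rV[int]_k) :
  zonotopal_tiling I Gam Sig -> tile I Gam Sig (cell I Gam s) ->
  g^T = e *m Gam -> (forall a, a \notin sS s -> g a 0 = 0) -> g = 0.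
Proof.
move=> tiling maxs ge gS; apply/matrixP => a j; rewrite ord1 [RHS]mxE.
have [aS|/gS//] := boolP (a \in sS s).
have w0 c : 0 < width c by case/andP: (width_bounds c).
(* The centre x of the face and the direction v along the arc a, pointing into
   the box. *)
pose x : 'cV[R]_m := \col_c if c \in sL s then lo I c 0
  else if c \in sU s then hi I c 0 else (lo I c 0 + hi I c 0) / 2.
pose sg : R := if a \in sL s then 1 else -1.
pose v : 'cV[R]_m := \col_c if c == a then sg * width c else 0.
have lpx : lp_face I s x.
  split=> [c|c cL|c cU]; rewrite mxE.
  - have := w0 c; case: (c \in sL s); first by move=> ?; lra.
    by case: (c \in sU s) => ?; lra.
  - by rewrite cL.
  - by case: (arc_cases s c) => [[_ /negP]|[_ /negbTE->]|];
      rewrite ?in_structure ?cU ?orbT.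
have omD (y z : 'cV[R]_m) :
    offset_map I Gam (y + z) = offset_map I Gam y + offset_map I Gam z.
  by rewrite /offset_map mulmxDr scalerDr.
have omZ (t : R) (y : 'cV[R]_m) :
    offset_map I Gam (t *: y) = t *: offset_map I Gam y.
  by rewrite /offset_map -scalemxAr !scalerA mulrC.
have [|y|t|t t0] := maximal_cell_direction (x := offset_map I Gam x)
  (v := offset_map I Gam v) tiling maxs.
- by rewrite cellE; exists x.
(* The face is symmetric about [x]: its free coordinates are midpoints and the others are fixed. *)
- rewrite cellE => -[y' [box_y yL yU] <-]; exists (x + x - y'); last first.
    by rewrite -scaleN1r !omD omZ scaleN1r.
  have [_ xL xU] := lpx.
  split=> [c|c cL|c cU]; rewrite !mxE.
  + have := box_y c; rewrite -/(x c 0).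
    case: (arc_cases s c) => [[cL _]|[cU cL]|].
    * by rewrite cL (yL c) //; move=> ?; lra.
    * by rewrite (negbTE cL) cU (yU c) //; move=> ?; lra.
    * rewrite in_structure negb_or => /andP[/negbTE-> /negbTE->] ?; lra.
  + by rewrite cL yL // addrK.
  + by have := xU c cU; rewrite yU // mxE => ->; rewrite addrK.
- move=> t01; exists (x + t *: v); last by rewrite omD omZ.
  move=> c; rewrite !mxE; have wc := w0 c.
  case: eqVneq => [ca|_]; last first.
    by have [/(_ c)] := lpx; rewrite mxE mulr0 addr0.
  rewrite ca in wc *.
  rewrite /sg; case: (arc_cases s a) => [[aL _]|[aU /negbTE aL]|]; last by rewrite aS.
    by rewrite aL mul1r; apply/andP; split; nra.
  by rewrite aL aU mulN1r; apply/andP; split; nra.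
rewrite cellE => -[y lpy]; rewrite -omZ -omD.
move/(congr1 (fun z => T *: z)); rewrite /offset_map !scalerA.
rewrite divff ?lt0r_neq0 ?period_gt0 // !scale1r.
(* Applying [e] replaces [Gam] by [g]. Off [sS s] this is zero, and on it [y] agrees with the moved
   point except at [a], so only the term of [a] survives. *)
move/(congr1 (mulmx (map_mx intr e : 'rV[R]_k))).
rewrite !mulmxA -map_mxM -ge => /matrixP/(_ 0 0); rewrite !mxE => /eqP.
rewrite -subr_eq0 -sumrB (bigD1 a) //= big1 ?addr0; last first.
  move=> c ca; rewrite !mxE.
  have [cS|/gS->] := boolP (c \in sS s); last by rewrite !mul0r subrr.
  rewrite (lp_face_eq lpy lpx cS) mxE (negbTE ca) mulr0 addr0 subrr //.
rewrite (lp_face_eq lpy lpx aS) -mulrBr [(x + _) a 0]mxE opprD addNKr.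
rewrite [(t *: v) a 0]mxE [v a 0]mxE eqxx.
rewrite mulrN oppr_eq0 !mulf_eq0 (gt_eqF t0) (gt_eqF (w0 a)).
have -> : (sg == 0) = false.
  by rewrite /sg; case: ifP; rewrite ?oppr_eq0 oner_eq0.
by rewrite !mxE !orbF intr_eq0 => /eqP.
Qed.

End Matrix.

(** * Periodic tensions and vertices of polytropes *)

Lemma tensionE (p : 'cV[int]_m) (pi : 'cV[R]_n) a :
  tension I p pi a 0 = pi (head G a) 0 - pi (tail G a) 0 + T * (p a 0)%:~R.
Proof.
rewrite /tension mxE [X in X + _]mxE [X in _ + X]mxE [X in _ + _ * X]mxE.
by rewrite mul_trmx_incidence opprB.
Qed.

Lemma timetablesE (p : 'cV[int]_m) (pi : 'cV[R]_n) :
  timetables I p pi <-> in_box (lo I) (hi I) (tension I p pi).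
Proof. by split=> h a; have := h a; rewrite tensionE lerBDr lerBrDr. Qed.

Lemma lp_face_vertex (s : structure m) (p : 'cV[int]_m) (pi : 'cV[R]_n) :
  spanning_tree_structure G s -> lp_face I s (tension I p pi) ->
  vertex_mod1 (timetables I p) pi.
Proof.
move=> [conn _] [box xL xU]; split; first exact/timetablesE.
pose sg a : R := (a \in sU s)%:R - (a \in sL s)%:R.
pose c : 'rV[R]_n := - (\row_a sg a *m (map_mx intr (incidence G))^T).
have cE (rho : 'cV[R]_n) : (c *m rho) 0 0 =
    \sum_a sg a * (rho (head G a) 0 - rho (tail G a) 0).
  rewrite /c mulNmx -mulmxA -mulmxN mxE; apply: eq_bigr => a _; congr (_ * _).
    by rewrite mxE.
  have := tensionE 0 rho a; rewrite /tension map_mx0 scaler0 addr0 => ->.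
  by rewrite mxE mulr0 addr0.
exists c; split.
  apply/matrixP => i j; rewrite !ord1 cE mxE big1 // => a _.
  by rewrite !mxE subrr mulr0.
(* The equality case is recorded so that equal sums force equality on every arc of [sS s];
   connectedness then makes [rho - pi] constant. *)
have term rho a : timetables I p rho ->
    sg a * (rho (head G a) 0 - rho (tail G a) 0)
      <= sg a * (pi (head G a) 0 - pi (tail G a) 0)
    ?= iff ((a \in sS s) ==> (rho (head G a) 0 - rho (tail G a) 0
                        == pi (head G a) 0 - pi (tail G a) 0)).
  move=> /(_ a) rhoa; rewrite /sg in_structure.
  case: (arc_cases s a) => [[aL /negbTE aU]|[aU /negbTE aL]|].
  - have := xL a aL; rewrite tensionE aL aU sub0r !mulN1r /= => e.
    split; first by lra.
    by rewrite eqr_opp.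
  - have := xU a aU; rewrite tensionE aL aU subr0 !mul1r /= => e.
    by split => //; lra.
  - rewrite in_structure negb_or => /andP[/negbTE-> /negbTE->].
    by rewrite subrr !mul0r; split; rewrite ?eqxx.
apply/seteqP; split=> [rho [rhoP max]|_ [d _ <-]].
  have le : \sum_a sg a * (rho (head G a) 0 - rho (tail G a) 0)
     <= \sum_a sg a * (pi (head G a) 0 - pi (tail G a) 0)
     ?= iff [forall a, (a \in sS s) ==> (rho (head G a) 0 - rho (tail G a) 0
                        == pi (head G a) 0 - pi (tail G a) 0)].
    by apply: leif_sum => a _; apply: term.
  have := le.2; rewrite eq_le le.1 -!cE max /=; last first.
    exact/timetablesE.
  move=> /esym/forallP tight.
  case: IP => _ _ [n2 _ _] _ _; pose r := Ordinal (ltn_trans (ltn0Sn 1) n2).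
  exists (rho r 0 - pi r 0) => //.
  apply/matrixP => v j; rewrite ord1 !mxE.
  have /(_ v r) : forall v w, rho v 0 - pi v 0 = rho w 0 - pi w 0.
    apply: (connected_constant conn) => a aS.
    have := tight a; rewrite aS /= => /eqP; lra.
  by move=> <-; ring.
have shift a : (pi + const_mx d) (head G a) 0 - (pi + const_mx d) (tail G a) 0 =
    pi (head G a) 0 - pi (tail G a) 0 by rewrite !mxE; ring.
split=> [a|rho rhoP]; first by rewrite shift; move/timetablesE: box; apply.
rewrite !cE; apply: ler_sum => a _; rewrite shift.
exact: (term rho a rhoP).1.
Qed.

(* Tensions of equivalent timetables differ by multiples of T, and the box has
   side lengths less than T. *)
Lemma torus_class_tension (p p' : 'cV[int]_m) (pi pi' : 'cV[R]_n) :
  timetables I p pi -> timetables I p' pi' ->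
  torus_class I pi = torus_class I pi' -> tension I p' pi' = tension I p pi.
Proof.
move=> /timetablesE box /timetablesE box' e.
have : torus_class I pi pi'.
  by rewrite e; exists 0, 0; rewrite map_mx0 scaler0 !addr0.
case=> q [c pi'E]; apply/matrixP => a j; rewrite ord1.
have := box a; have := box' a.
have /andP[w0 wT] := width_bounds a.
set x' := tension I p' pi' a 0; set x := tension I p pi a 0.
(* The additive constant between the two timetables cancels along an arc, so only integer multiples
   of the period remain. *)
pose N : int := q (head G a) 0 - q (tail G a) 0 + p' a 0 - p a 0.
have xN : x' = x + T * N%:~R.
  rewrite /x' /x !tensionE pi'E !mxE /N rmorphB rmorphD rmorphB /=; ring.
rewrite xN => /andP[h1 h2] /andP[h3 h4].
have T0 := period_gt0.
suff -> : N = 0 by rewrite mulr0 addr0.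
have : N < 1 by rewrite -(ltr_int R) mulr1z -(ltr_pM2l T0); lra.
have : -1 < N by rewrite -(ltr_int R) mulrN1z -(ltr_pM2l T0); lra.
lia.
Qed.

End Pesp.

Unset Implicit Arguments.

Theorem theorem4p13 (R : realType) (n m : nat) (I : pesp R n m)
    (hI : pesp_instance I)
    (b : (cyclomatic n m).-tuple 'cV[int]_m)
    (hb : integral_cycle_basis (graph I) b)
    (Sig : set (structure m))
    (hSig : zonotopal_tiling I (cycle_matrix b) Sig)
    (hfine : fine I (cycle_matrix b) Sig)
    (Q : set 'cV[R]_(cyclomatic n m))
    (hQ : tile I (cycle_matrix b) Sig Q) :
  (exists s : structure m,
     spanning_tree_structure (graph I) s /\
     Q = offset_map I (cycle_matrix b) @` lp_face I s) /\
  (forall s : structure m,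
     spanning_tree_structure (graph I) s ->
     Q = offset_map I (cycle_matrix b) @` lp_face I s ->
     forall z : 'cV[int]_(cyclomatic n m),
       Q (map_mx intr z) ->
       exists2 th, polytrope_vertex I (cycle_matrix b) z th
                 & defined_by I (cycle_matrix b) z th s).
Proof.
have [_ simp [n2 _ _] anti _] := hI.
have n0 : (0 < n)%N by apply: ltn_trans n2.
split.
  (* The sign vector labelling the tile in [Sig] is the required structure. *)
  have [[s Sigs sQ] _] := hQ; rewrite -sQ in hQ *.
  exists s; split; last exact: cellE.
  split.
    apply: (cell_connected hI _ (hfine s Sigs hQ)).
    exact: cycle_matrix_incidence hb.
  move=> c cyc; rewrite leqNgt; apply/negP => sz.
  have [g [gcyc /eqP g0 gS]] := ucycle_circulation simp anti cyc sz.
  have [e ge] := oriented_cycle_coord hb gcyc.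
  by apply: g0; apply: (maximal_cell_support hI hSig hQ ge gS).
move=> s tree QE z; rewrite QE => -[x lpx xz].
have T0 := lt0r_neq0 (period_gt0 hI).
have [p pz] := cycle_matrix_surj hb simp anti n0 z tree.
(* Both [x] and the period times [p] have offset [z], so their difference is the tension of a
   potential. *)
have : map_mx intr (cycle_matrix b) *m
    (x - (period I)%:R *: map_mx intr p) = 0 :> 'cV[R]_(cyclomatic n m).
  rewrite mulmxBr -scalemxAr -map_mxM pz -xz /offset_map scalerA divff //.
  by rewrite scale1r subrr.
case/(cycle_matrix_ker hb simp anti n0 tree) => rho rhoE.
(* The sign comes from the convention that tensions are minus the transposed incidence matrix times
   the potential. *)
have xE : tension I p (- rho) = x by rewrite /tension mulmxN opprK -rhoE subrK.
have tt : timetables I p (- rho) by apply/timetablesE; rewrite xE; case: lpx.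
exists (torus_class I (- rho)).
  split; exists p, (- rho); split=> //.
  by apply: (lp_face_vertex hI tree); rewrite xE.
(* Every other representative of the torus point has the same tension [x]. *)
move=> p' pi' _ tt' e; rewrite (torus_class_tension hI tt tt' e) xE.
by case: lpx.
Qed.
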